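(* Let $k\ge 4$ be even and let $G=(V,E)$ be a $k$-uniform hypercycle of size $s$. Let $\mathcal L$ be its Laplacian tensor. Then $\lambda(\mathcal L)=2+2\beta^{k-2}$, where $\beta$ is the unique positive solution of the equation $2\beta^k+\beta^2-1=0$, which lies in the interval $(\frac12,1)$.
   Context: A $k$-uniform hypergraph $G=(V,E)$ has vertex set $V=[n]=\{1,\dots,n\}$ and edges that are $k$-element subsets of $V$. It is a hypercycle of size $s\ge 3$ if $V=V_1\cup\dots\cup V_s$ with $|V_1|=\dots=|V_s|=k$ such that (i) $E=\{V_i: i\in[s]\}$; (ii) $|V_1\cap V_2|=\dots=|V_{s-1}\cap V_s|=|V_s\cap V_1|=1$, and $V_i\cap V_j=\emptyset$ for all other pairs $i\ne j$; (iii) the intersections $V_1\cap V_2,\dots,V_{s-1}\cap V_s,V_s\cap V_1$ are mutually different. (Such a $G$ has $n=s(k-1)$ vertices.) The degree $d_i$ of vertex $i$ is the number of edges containing $i$. The adjacency tensor $\mathcal A$ is the $k$-th order $n$-dimensional tensor with $a_{i_1\dots i_k}=\frac1{(k-1)!}$ if $\{i_1,\dots,i_k\}\in E$ and $0$ otherwise; $\mathcal D$ is the diagonal tensor with diagonal entries $d_{i\dots i}=d_i$; the Laplacian tensor is $\mathcal L=\mathcal D-\mathcal A$. Thus $(\mathcal L\mathbf x^{k-1})_i=d_ix_i^{k-1}-\sum_{e\in E,\,i\in e}\prod_{j\in e\setminus\{i\}}x_j$. A real number $\lambda$ is an H-eigenvalue of $\mathcal L$ with H-eigenvector $\mathbf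 x\in\mathbb R^n\setminus\{0\}$ if $(\mathcal L\mathbf x^{k-1})_i=\lambda x_i^{k-1}$ for all $i\in[n]$. $\lambda(\mathcal L)$ denotes the largest H-eigenvalue of $\mathcal L$ (it exists). *)

(* Defs.v *)
From HB Require Import structures.
From mathcomp Require Import all_boot all_order all_algebra.
From mathcomp Require Import reals.

Set Implicit Arguments.
Unset Strict Implicit.
Unset Printing Implicit Defensive.

Import Order.TTheory GRing.Theory Num.Theory.
Local Open Scope ring_scope.

Definition hypergraph (n : nat) := {set {set 'I_n}}.

Definition uniform (n k : nat) (E : hypergraph n) : Prop :=
  forall e : {set 'I_n}, e \in E -> #|e| = k.

(* [ordS i] is the cyclic successor i + 1 mod s. *)
Definition hypercycle (n k s : nat) (E : hypergraph n) : Prop :=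
  (3 <= s)%N /\
  exists W : 'I_s -> {set 'I_n},
    [/\ \bigcup_(i < s) W i = [set: 'I_n] /\ (forall i, #|W i| = k),
        E = [set W i | i : 'I_s],
        forall i, #|W i :&: W (ordS i)| = 1%N,
        forall i j, i != j -> j != ordS i -> i != ordS j ->
          W i :&: W j = set0
      & injective (fun i => W i :&: W (ordS i))].

Definition degree (n : nat) (E : hypergraph n) (i : 'I_n) : nat :=
  #|[set e in E | i \in e]|.

Definition tensor (R : realType) (k n : nat) := k.-tuple 'I_n -> R.

Definition adjacency_tensor (R : realType) (k n : nat) (E : hypergraph n) :
    tensor R k n :=
  fun t => if [set j in t] \in E then ((k.-1)`!%:R)^-1 else 0.

Definition diagonal_tensor (R : realType) (k n : nat) (d : 'I_n -> R) :
    tensor R k n :=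
  fun t => if tval t is i :: u then (if all (pred1 i) u then d i else 0) else 0.

Definition degree_tensor (R : realType) (k n : nat) (E : hypergraph n) :
    tensor R k n :=
  diagonal_tensor (fun i => (degree E i)%:R).

Definition laplacian_tensor (R : realType) (k n : nat) (E : hypergraph n) :
    tensor R k n :=
  fun t => degree_tensor R E t - adjacency_tensor R E t.

Arguments laplacian_tensor R k {n} E _.

(* (T x^{k-1})_i, the sum of t_{i i_2 ... i_k} x_{i_2} ... x_{i_k} over all
   i_2, ..., i_k: the index tuples of T with first component i. *)
Definition tensor_app (R : realType) (k n : nat) (T : tensor R k n)
    (x : 'rV[R]_n) (i : 'I_n) : R :=
  \sum_(t : k.-tuple 'I_n | ohead t == Some i)
    T t * \prod_(j <- behead t) x 0 j.

Definition H_eigenpair (R : realType) (k n : nat) (T : tensor R k n)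
    (lambda : R) (x : 'rV[R]_n) : Prop :=
  x != 0 /\ forall i, tensor_app T x i = lambda * x 0 i ^+ k.-1.

Definition H_eigenvalue (R : realType) (k n : nat) (T : tensor R k n)
    (lambda : R) : Prop :=
  exists x : 'rV[R]_n, H_eigenpair T lambda x.

Definition largest_H_eigenvalue (R : realType) (k n : nat) (T : tensor R k n)
    (lambda : R) : Prop :=
  H_eigenvalue T lambda /\ forall mu, H_eigenvalue T mu -> mu <= lambda.

(* Main.v *)
(** The key is that the Laplacian differs from the signless Laplacian D + A
    only by signs. If y > 0 satisfies ((D + A) y^(k-1))_i = lambda y_i^(k-1)
    for all i, then comparing any H-eigenvector x with y at a vertex maximising |x_i| / y_i
    shows that every H-eigenvalue of D - A is at most lambda. If moreover k is
    even and a set of vertices meets every edge in exactly one vertex, flipping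
    the sign of y on that set turns y into an H-eigenvector of D - A.
    In a hypercycle every edge has two vertices of degree 2 and k - 2 >= 2 of
    degree 1, so choosing one of the latter per edge gives such a set, and
    y = 1 on degree 2, y = beta on degree 1 works as soon as
    2 + 2 beta^(k-2) = 1 + beta^(-2). *)
Require Import Defs.
From HB Require Import structures.
From mathcomp Require Import all_boot all_order all_algebra.
From mathcomp Require Import reals.
From mathcomp Require Import ring lra.

Set Implicit Arguments.
Unset Strict Implicit.
Unset Printing Implicit Defensive.

Import Order.TTheory GRing.Theory Num.Theory.
Local Open Scope ring_scope.

(** * Tensor actions as sums over edges *)

Definition edge_sum (R : realType) (n : nat) (E : hypergraph n)
    (x : 'I_n -> R) (i : 'I_n) : R :=
  \sum_(e in E | i \in e) \prod_(j in e :\ i) x j.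

(** Distinctness of the entries is a matter of counting: [m.+1] entries can cover [m.+1] elements
    only without repetition. *)
Lemma set_cons_tuple_eq (n m : nat) (e : {set 'I_n}) (i : 'I_n)
    (u : m.-tuple 'I_n) : #|e| = m.+1 ->
  ([set j in i :: u] == e) = [&& i \in e, all (mem (e :\ i)) u & uniq u].
Proof.
move=> ce; apply/eqP/and3P => [eE|[ie /allP ue uu]].
  have cu : #|i :: u| = size (i :: u).
    by rewrite /= size_tuple -ce -eE cardsE.
  have /andP[iNu uu] : uniq (i :: u) by apply/card_uniqP.
  split=> //; first by rewrite -eE inE mem_head.
  apply/allP => j ju; rewrite /= !inE -eE inE in_cons ju orbT andbT.
  by apply: contraNneq iNu => <-.
apply/eqP; rewrite eqEcard; apply/andP; split.
  apply/subsetP => j; rewrite inE in_cons => /predU1P[-> //|/ue].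
  by rewrite /= !inE => /andP[].
rewrite ce cardsE; have /card_uniqP -> /= : uniq (i :: u).
  by rewrite /= uu andbT; apply/negP => /ue; rewrite /= !inE eqxx.
by rewrite size_tuple.
Qed.

Lemma prod_uniq_tuple (R : comNzRingType) (n m : nat) (A : {set 'I_n})
    (x : 'I_n -> R) (u : m.-tuple 'I_n) :
  #|A| = m -> all (mem A) u -> uniq u -> \prod_(j <- u) x j = \prod_(j in A) x j.
Proof.
move=> cA /allP uA uu; rewrite -[RHS]big_enum /=; apply: perm_big.
apply: uniq_perm; rewrite ?enum_uniq //.
have [] := @uniq_min_size _ u (enum A) uu; last by [].
- by move=> j /uA; rewrite mem_enum.
- by rewrite -cardE cA size_tuple.
Qed.

Lemma sum_tuple_head (R : nmodType) (n m : nat) (i : 'I_n)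
    (F : m.+1.-tuple 'I_n -> R) :
  \sum_(t : m.+1.-tuple 'I_n | ohead t == Some i) F t =
  \sum_(u : m.-tuple 'I_n) F [tuple of i :: u].
Proof.
rewrite (reindex_onto (fun u : m.-tuple 'I_n => [tuple of i :: u])
  (fun t => [tuple of behead t])) /=; last first.
  by move=> t; case/tupleP: t => j u /= /eqP[->]; apply: val_inj.
apply: eq_bigl => u; rewrite eqxx /=; apply/eqP; exact: val_inj.
Qed.

Lemma degree_tensor_app (R : realType) (n m : nat) (E : hypergraph n)
    (x : 'rV[R]_n) (i : 'I_n) :
  tensor_app (degree_tensor R E : tensor R m.+1 n) x i =
  (degree E i)%:R * x 0 i ^+ m.
Proof.
rewrite /tensor_app sum_tuple_head (bigD1 [tuple of nseq m i]) //=.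
rewrite {1}/degree_tensor /diagonal_tensor /= all_pred1_nseq.
rewrite [X in _ + X]big1 ?addr0 => [|u neq].
  by rewrite big_nseq iter_mulr_1.
rewrite /degree_tensor /diagonal_tensor /=.
case: ifP; rewrite ?mul0r // => /all_pred1P ui.
by case/eqP: neq; apply: val_inj; rewrite /= [LHS]ui size_tuple.
Qed.

(** Each edge through [i] comes from the [m]! orderings of its other vertices, which cancels the
    weight 1/[m]!. *)
Lemma adjacency_tensor_app (R : realType) (n m : nat) (E : hypergraph n)
    (x : 'rV[R]_n) (i : 'I_n) : uniform m.+1 E ->
  tensor_app (@adjacency_tensor R m.+1 n E) x i = edge_sum E (x 0) i.
Proof.
move=> unifE; rewrite /tensor_app sum_tuple_head.
rewrite (bigID (fun u : m.-tuple 'I_n => [set j in i :: u] \in E)) /=.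
rewrite [X in _ + X]big1 ?addr0 => [|u /negPf uE]; last first.
  by rewrite /adjacency_tensor /= uE mul0r.
(* Group the index tuples by the edge that they span together with [i]. *)
rewrite (partition_big (fun u : m.-tuple 'I_n => [set j in i :: u])
  (mem [pred e in E | i \in e])) /=; last first.
  by move=> u uE; rewrite inE uE !inE eqxx.
apply: eq_bigr => e /andP[eE ie].
have cD : #|e :\ i| = m by move: (unifE _ eE); rewrite (cardsD1 i e) ie => -[].
rewrite (eq_bigl [in [set t : m.-tuple 'I_n | all (mem (e :\ i)) t & uniq t]]).
  rewrite (eq_bigr (fun=> (m`!%:R)^-1 * \prod_(j in e :\ i) x 0 j)).
    rewrite sumr_const card_uniq_tuples cD ffactnn -[LHS]mulr_natl mulrA.
    by rewrite divff ?mul1r // pnatr_eq0 -lt0n fact_gt0.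
  move=> u; rewrite !inE => /andP[ua uu].
  rewrite /adjacency_tensor /= (prod_uniq_tuple _ cD ua uu).
  have /eqP -> : [set j in i :: u] == e.
    by rewrite (set_cons_tuple_eq _ _ (unifE _ eE)) ie ua.
  by rewrite eE.
move=> u; rewrite /= inE.
have -> : all (mem (e :\ i)) u && uniq u = ([set j in i :: u] == e).
  by rewrite (set_cons_tuple_eq _ _ (unifE _ eE)) ie.
by case: eqP => [->|_]; rewrite ?eE ?andbF.
Qed.

Lemma laplacian_tensor_app (R : realType) (n m : nat) (E : hypergraph n)
    (x : 'rV[R]_n) (i : 'I_n) : uniform m.+1 E ->
  tensor_app (laplacian_tensor R m.+1 E) x i =
  (degree E i)%:R * x 0 i ^+ m - edge_sum E (x 0) i.
Proof.
move=> unifE; rewrite -degree_tensor_app -(adjacency_tensor_app _ _ unifE).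
by rewrite /tensor_app -sumrB; apply: eq_bigr => t _; rewrite mulrBl.
Qed.

(** * Comparing the Laplacian with the signless Laplacian *)

Lemma H_eigenvalue_le (R : realType) (n m : nat) (E : hypergraph n)
    (y : 'I_n -> R) (lambda mu : R) :
  uniform m.+1 E -> (forall i, 0 < y i) ->
  (forall i, (degree E i)%:R * y i ^+ m + edge_sum E y i = lambda * y i ^+ m) ->
  H_eigenvalue (laplacian_tensor R m.+1 E) mu -> mu <= lambda.
Proof.
move=> unifE y0 yE [x [xn0 xE]].
(* A nonzero coordinate makes the maximal ratio positive, so that its power can be cancelled at the
   end. *)
have [i0 xi0] : exists i, x 0 i != 0.
  apply/existsP; apply: contraNT xn0 => /existsPn x0.
  apply/eqP/matrixP => a j; rewrite ord1 mxE; apply/eqP.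
  by have := x0 j; rewrite negbK.
pose q i := `|x 0 i| / y i.
have [i _ qmax] := @arg_maxP _ _ _ i0 predT q isT.
have q0 : 0 < q i.
  apply: lt_le_trans (qmax i0 isT).
  by rewrite divr_gt0 ?normr_gt0.
have xy j : `|x 0 j| <= q i * y j by rewrite -ler_pdivrMr ?y0 //; exact: qmax.
have xi : `|x 0 i| = q i * y i by rewrite divfK // gt_eqF.
(* Triangle inequality, then [xy] in each of the [m] factors of every edge term. *)
have ES : `|edge_sum E (x 0) i| <= q i ^+ m * edge_sum E y i.
  rewrite mulr_sumr; apply: le_trans (ler_norm_sum _ _ _) _.
  apply: ler_sum => e /andP[eE ie].
  have cD : #|e :\ i| = m by move: (unifE _ eE); rewrite (cardsD1 i e) ie => -[].
  rewrite normr_prod -cD -prodr_const -big_split /=.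
  by apply: ler_prod => j _; rewrite normr_ge0 xy.
have Ei : edge_sum E (x 0) i = ((degree E i)%:R - mu) * x 0 i ^+ m.
  by have := xE i; rewrite laplacian_tensor_app // => H; rewrite mulrBl -H; ring.
have yi : edge_sum E y i = (lambda - (degree E i)%:R) * y i ^+ m.
  by rewrite mulrBl -yE; ring.
(* Cancelling the powers of [q i] and [y i] leaves |d - [mu]| <= [lambda] - d, where d is the degree
   of [i]. *)
move: ES; rewrite Ei yi normrM normrX xi exprMn mulrCA ler_pM2l ?exprn_gt0 //.
rewrite ler_pM2r ?exprn_gt0 // => h.
have := ler_norm (- ((degree E i)%:R - mu)); rewrite normrN; lra.
Qed.

(** The signs multiply to -1 over each edge, hence to [- sg i] over the edge without [i]. As [m] is
    odd, [sg i ^+ m] is [sg i], so the flip negates the adjacency part relative to the diagonal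
    part. The vertex [v0] supplies a coordinate at which the flipped vector is nonzero. *)
Lemma H_eigenvalue_odd_bipartite (R : realType) (n m : nat) (E : hypergraph n)
    (y : 'I_n -> R) (lambda : R) (N : {set 'I_n}) (v0 : 'I_n) :
  uniform m.+1 E -> odd m -> (forall i, 0 < y i) ->
  (forall i, (degree E i)%:R * y i ^+ m + edge_sum E y i = lambda * y i ^+ m) ->
  (forall e, e \in E -> odd #|e :&: N|) ->
  H_eigenvalue (laplacian_tensor R m.+1 E) lambda.
Proof.
move=> unifE odd_m y0 yE EN; pose sg i : R := (-1) ^+ (i \in N).
have sg2 i : sg i * sg i = 1 by rewrite -expr2 sqrr_sign.
have sgm i : sg i ^+ m = sg i by rewrite -exprM mulnC exprM -signr_odd odd_m.
have prod_sg e i : e \in E -> i \in e -> \prod_(j in e :\ i) sg j = - sg i.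
  move=> eE ie; have : \prod_(j in e) sg j = -1.
    rewrite prodrXr -signr_odd; suff -> : (\sum_(j in e) (j \in N) = #|e :&: N|)%N.
      by rewrite EN.
    rewrite -sum1_card big_mkcond [RHS]big_mkcond; apply: eq_bigr => j _.
    by rewrite inE; case: (j \in e); case: (j \in N).
  by rewrite (big_setD1 i ie) /= => h; rewrite -[LHS]mul1r -[X in X * _](sg2 i) -mulrA h mulrN1.
exists (\row_i (sg i * y i)); split=> [|i].
  apply/eqP => /rowP/(_ v0); rewrite !mxE => /eqP.
  by rewrite mulf_eq0 (gt_eqF (y0 _)) orbF signr_eq0.
rewrite laplacian_tensor_app // mxE exprMn sgm mulrCA [RHS]mulrCA -yE.
suff -> : edge_sum E ((\row_i (sg i * y i)) 0) i = - (sg i * edge_sum E y i).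
  by rewrite opprK mulrDr.
rewrite mulr_sumr -sumrN; apply: eq_bigr => e /andP[eE ie].
rewrite -mulNr -(prod_sg e) // -big_split /=.
by apply: eq_bigr => j _; rewrite mxE.
Qed.

(** * Combinatorics of the hypercycle *)

Lemma ordS_neq (s : nat) (i : 'I_s) : (1 < s)%N -> ordS i != i.
Proof.
move=> s1; apply/eqP => /(congr1 val) /=.
have [lt|lt|eq_s] := ltngtP i.+1 s.
- by rewrite modn_small // => /eqP; rewrite eqn_leq ltnn.
- by have := ltn_ord i; rewrite leqNgt lt.
- by rewrite eq_s modnn => i0; move: s1; rewrite -eq_s -i0.
Qed.

(** Extracts all that the spectral argument uses of the cycle structure. The degree 2 vertices of
    [W i] are its joints with the next and the previous edge, which differ because the consecutive
    intersections do. *)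
Lemma hypercycle_degrees (n k s : nat) (E : hypergraph n) :
  (4 <= k)%N -> hypercycle k s E ->
  [/\ E != set0, forall v, degree E v = 1%N \/ degree E v = 2
    & forall e, e \in E -> #|[set v in e | degree E v == 2]| = 2].
Proof.
move=> k4 [s3 [W [[coverW cardW] -> cardI disjW injI]]].
have s0 : (0 < s)%N by apply: leq_trans s3.
have ordSn i : ordS i != i :> 'I_s by apply: ordS_neq; apply: leq_trans s3.
have predn i : ord_pred i != i :> 'I_s.
  by have := ordSn (ord_pred i); rewrite ord_predK eq_sym.
have {}injI i j : W i :&: W (ordS i) = W j :&: W (ordS j) -> i = j.
  exact: injI.
have adj i j v : v \in W i -> v \in W j -> [\/ i = j, j = ordS i | i = ordS j].
  move=> vi vj; have [->|ij] := eqVneq i j; first exact: Or31.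
  have [->|ji] := eqVneq j (ordS i); first exact: Or32.
  have [->|ij'] := eqVneq i (ordS j); first exact: Or33.
  by have /setP/(_ v) := disjW i j ij ji ij'; rewrite !inE vi vj.
have joint_sub i v : v \in W i -> v \in W (ordS i) ->
    W i :&: W (ordS i) = [set v].
  move=> vi vS; apply/eqP; rewrite eq_sym eqEcard cardI cards1 leqnn andbT.
  by rewrite sub1set inE vi vS.
(* No vertex lies in three edges. When [s] is 3 all edges are pairwise adjacent, and only the
   distinctness of the intersections excludes a common vertex. *)
have joint i v : v \in W i -> v \in W (ordS i) ->
    [set j | v \in W j] = [set i; ordS i].
  move=> vi vS; apply/setP => j; rewrite !inE; apply/idP/orP => [vj|]; last first.
    by case=> /eqP->.
  have [ij|->|ij] := adj i j v vi vj; [by rewrite ij eqxx; left| by right |].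
  have vSj : v \in W (ordS j) by rewrite -ij.
  by left; apply/eqP; apply: injI; rewrite (joint_sub _ _ vi vS) (joint_sub _ _ vj vSj).
(* Lets degrees count indices instead of edges: sets with different indices share at most one
   vertex, but each has [k] >= 4. *)
have injW : injective W.
  move=> i j Wij; apply/eqP/negPn/negP => ij.
  have lt1 : (#|W i :&: W j| <= 1)%N.
    have [->|ji] := eqVneq j (ordS i); first by rewrite cardI.
    have [->|ij'] := eqVneq i (ordS j); first by rewrite setIC cardI.
    by rewrite disjW ?cards0.
  by move: lt1; rewrite Wij setIid cardW leqNgt (leq_trans _ k4).
pose IE := [set W i | i : 'I_s].
have degE v : degree IE v = #|[set j | v \in W j]|.
  rewrite /degree -(card_imset _ injW); apply: eq_card => e; rewrite !inE.
  apply/andP/imsetP => [[/imsetP[i _ ->] vi]|[i]]; first by exists i; rewrite ?inE.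
  by rewrite inE => vi ->; rewrite imset_f.
have deg2 i v : v \in W i ->
    (degree IE v == 2) = (v \in W i :&: (W (ordS i) :|: W (ord_pred i))).
  move=> vi; rewrite degE !inE vi /=.
  have [vS|vS] /= := boolP (v \in W (ordS i)).
    by rewrite (joint i v vi vS) cards2 [i == _]eq_sym ordSn.
  have [vP|vP] /= := boolP (v \in W (ord_pred i)).
    have := joint (ord_pred i) v vP; rewrite ord_predK => /(_ vi) ->.
    by rewrite cards2 predn.
  have -> : [set j | v \in W j] = [set i].
    apply/setP => j; rewrite !inE; apply/idP/eqP => [vj|-> //].
    have [//|ji|ij] := adj i j v vi vj; first by rewrite -ji vj in vS.
    by rewrite ij ordSK vj in vP.
  by rewrite cards1.
split=> [|v|e /imsetP[i _ ->]].
- by apply/set0Pn; exists (W (Ordinal s0)); rewrite imset_f.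
- have /bigcupP[i _ vi] : v \in \bigcup_(i < s) W i by rewrite coverW inE.
  have [|d] := boolP (degree IE v == 2); first by move/eqP; right.
  left; rewrite degE; apply/eqP/cards1P; exists i.
  apply/setP => j; rewrite !inE; apply/idP/eqP => [vj|-> //].
  move: d; rewrite (deg2 i) // !inE vi /= negb_or => /andP[vS vP].
  have [//|ji|ij] := adj i j v vi vj; first by rewrite -ji vj in vS.
  by rewrite ij ordSK vj in vP.
- have -> : [set v in W i | degree IE v == 2] =
      (W i :&: W (ordS i)) :|: (W (ord_pred i) :&: W (ordS (ord_pred i))).
    apply/setP => v; rewrite !inE ord_predK.
    have [vi|vi] := boolP (v \in W i); last by rewrite andbF.
    by rewrite (deg2 i) // !inE vi andbT.
  have /eqP/cards1P[a Ea] := cardI i.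
  have /eqP/cards1P[b Eb] := cardI (ord_pred i).
  rewrite Ea Eb cards2; suff -> : a != b by [].
  apply/eqP => ab; have /injI ip : W i :&: W (ordS i) =
      W (ord_pred i) :&: W (ordS (ord_pred i)) by rewrite Ea Eb ab.
  by have := predn i; rewrite -ip eqxx.
Qed.

(** * The equation for [beta] *)

Lemma cycle_equation_root (R : realType) (k : nat) : (4 <= k)%N ->
  exists2 beta : R, unique (fun b : R => 0 < b /\ 2 * b ^+ k + b ^+ 2 - 1 = 0) beta
    & 1 / 2 < beta < 1.
Proof.
move=> k4; pose f (b : R) := 2 * b ^+ k + b ^+ 2 - 1.
have f_inc a b : 0 <= a -> a < b -> f a < f b.
  move=> a0 ab; have k0 : k != 0 by case: (k) k4.
  have hk : a ^+ k < b ^+ k by rewrite ltrXn2r.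
  have h2 : a ^+ 2 < b ^+ 2 by rewrite ltrXn2r.
  rewrite /f; lra.
(* At 1/2 the value is at most 2/16 + 1/4 - 1, since [k] >= 4. *)
have f_half : f (1 / 2) < 0.
  have : (1 / 2 : R) ^+ k <= (1 / 2) ^+ 4 by rewrite ler_wiXn2l //; lra.
  rewrite /f; move: (_ ^+ k) => t ht; nra.
have f1 : f 1 = 2 by rewrite /f !expr1n; ring.
pose p : {poly R} := 2%:P * 'X^k + 'X^2 - 1.
have pE b : p.[b] = f b by rewrite /p /f !hornerE.
have [||b /andP[b_ge b_le] /rootP] := @poly_ivt R p (1 / 2) 1; first lra.
  by rewrite !pE f1 ltW //=; lra.
rewrite pE => fb; have b0 : 0 < b by lra.
exists b.
  split=> [//|c [c0 fc]]; have [bc|cb|//] := ltgtP b c.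
    by have := f_inc b c (ltW b0) bc; rewrite fb [f c]fc ltxx.
  by have := f_inc c b (ltW c0) cb; rewrite fb [f c]fc ltxx.
rewrite !lt_neqAle b_ge b_le !andbT; apply/andP; split.
  by apply: contraTneq f_half => ->; rewrite fb ltxx.
by apply: contra_eqN fb => /eqP ->; rewrite f1 pnatr_eq0.
Qed.

(** * The sign pattern and the positive eigenvector *)

Lemma odd_transversal (n : nat) (E : hypergraph n) :
  (forall e, e \in E -> exists2 v, v \in e & degree E v = 1%N) ->
  exists N : {set 'I_n}, forall e, e \in E -> odd #|e :&: N|.
Proof.
move=> core.
(* The choice is recorded as a singleton, so that [set0] can serve as the value on sets that are not
   edges. *)
have [f fE] : exists f : {set 'I_n} -> {set 'I_n}, forall e, e \in E ->
    exists2 v, v \in e & degree E v = 1%N /\ f e = [set v].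
  apply: (@fin_all_exists _ _ (fun e A => e \in E ->
    exists2 v, v \in e & degree E v = 1%N /\ A = [set v])) => e.
  have [eE|eE] := boolP (e \in E); last by exists set0.
  by have [v ve d] := core e eE; exists [set v] => _; exists v.
exists (\bigcup_(e in E) f e) => e eE; have [v ve [_ fe]] := fE e eE.
suff -> : e :&: \bigcup_(e in E) f e = [set v] by rewrite cards1.
apply/setP => w; rewrite !inE; apply/andP/eqP => [[we /bigcupP[e' e'E]]|->].
  have [v' v'e' [d fe']] := fE e' e'E; rewrite fe' inE => /eqP wv'.
  have /eqP/cards1P[g gE] := d.
  (* A chosen vertex has degree 1, so finding it in [e] forces its edge [e'] to be [e]. *)
  have inj h : h \in E -> v' \in h -> h = g.
    by move=> hE v'h; apply/set1P; rewrite -gE inE hE.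
  have ee' : e = e' by rewrite (inj e) -?wv' // -(inj e').
  by apply/set1P; rewrite -fe ee' fe' wv' set11.
by split=> //; apply/bigcupP; exists e; rewrite ?fe ?set11.
Qed.

Lemma signless_eigenvector (R : realType) (n m : nat) (E : hypergraph n)
    (b : R) (y := fun v => if degree E v == 2 then 1 else b) :
  uniform m.+3 E -> (forall v, degree E v = 1%N \/ degree E v = 2) ->
  (forall e, e \in E -> #|[set v in e | degree E v == 2]| = 2) ->
  0 < b -> 2 * b ^+ m.+3 + b ^+ 2 - 1 = 0 ->
  forall v, (degree E v)%:R * y v ^+ m.+2 + edge_sum E y v =
    (2 + 2 * b ^+ m.+1) * y v ^+ m.+2.
Proof.
move=> unifE deg12 joints b0 bE v.
have y0 : y v != 0 by rewrite /y; case: ifP => _; rewrite ?oner_eq0 ?gt_eqF.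
(* The two joints contribute 1 each, the other [m.+1] vertices [b] each. *)
have edge_prod e : e \in E -> \prod_(j in e) y j = b ^+ m.+1.
  move=> eE; rewrite (bigID (fun v => degree E v == 2)) /= big1 ?mul1r.
    rewrite (eq_bigr (fun=> b)) => [|j /andP[_ /negPf dj]]; last first.
      by rewrite /y dj.
    have := cardsID [set v | degree E v == 2] e; rewrite (unifE e eE).
    have -> : e :&: [set v | degree E v == 2] = [set v in e | degree E v == 2].
      by apply/setP => w; rewrite !inE.
    rewrite joints // prodr_const => -[<-]; congr (_ ^+ _).
    by apply: eq_card => w; rewrite !inE andbC.
  by move=> j /andP[_ dj]; rewrite /y dj.
have sumE : y v * edge_sum E y v = (degree E v)%:R * b ^+ m.+1.
  rewrite mulr_sumr (eq_bigr (fun=> b ^+ m.+1)) => [|e /andP[eE ve]]; last first.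
    by rewrite -(edge_prod e eE) (big_setD1 v ve).
  rewrite sumr_const mulr_natl; congr (_ *+ _).
  by apply: eq_card => e; rewrite !inE.
(* Multiplying by [y v] completes each edge term to a full edge product. At degree 2 the identity is
   then immediate. *)
apply: (mulfI y0); rewrite mulrDr sumE /y.
case: (deg12 v) => -> /=; last by rewrite !expr1n; ring.
move: bE; rewrite !exprS; move: (b ^+ m) => t bE.
apply/eqP; rewrite -subr_eq0; apply/eqP.
(* At degree 1 the two sides differ by -[b ^+ m.+1] times the left side of the equation for [b]. *)
by rewrite -[RHS](mulr0 (- (b * t))) -bE; ring.
Qed.

Theorem corollary5p1 (R : realType) (n k s : nat) (E : hypergraph n)
    (hk : (4 <= k)%N) (k_even : ~~ odd k)
    (E_uniform : uniform k E) (E_cycle : hypercycle k s E) :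
  exists beta : R,
    [/\ unique (fun b : R => 0 < b /\ 2 * b ^+ k + b ^+ 2 - 1 = 0) beta,
        1 / 2 < beta < 1
      & largest_H_eigenvalue (laplacian_tensor R k E)
          (2 + 2 * beta ^+ (k - 2)%N)].
Proof.
have [beta beta_uniq beta_range] := cycle_equation_root R hk.
have [[b0 bE] _] := beta_uniq.
exists beta; split=> //.
have [/set0Pn[e0 e0E] deg12 joints] := hypercycle_degrees hk E_cycle.
have [v0 _] : exists v, v \in e0.
  by apply/set0Pn; rewrite -card_gt0 (E_uniform _ e0E); apply: leq_trans hk.
have core e : e \in E -> exists2 v, v \in e & degree E v = 1%N.
  move=> eE; suff /set0Pn[v] : e :\: [set v in e | degree E v == 2] != set0.
    by rewrite !inE => /andP[+ ve]; rewrite ve; case: (deg12 v) => d; [exists v | rewrite d].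
  rewrite -card_gt0 cardsD (setIidPr _); last by apply/subsetP => v; rewrite inE => /andP[].
  by rewrite joints // E_uniform // subn_gt0; apply: leq_trans hk.
have [N EN] := odd_transversal core.
(* With [k] = [m.+3] the eigenvector exponent [k] - 1 is [m.+2], odd since [k] is even. *)
case: k hk k_even E_uniform bE {E_cycle beta_uniq} => [|[|[|m]]] // hk k_even unifE bE.
rewrite subSS subSS subn0.
have yE := signless_eigenvector unifE deg12 joints b0 bE.
have y0 v : 0 < (if degree E v == 2 then 1 else beta : R) by case: ifP.
split; last by move=> mu; apply: (H_eigenvalue_le unifE y0 yE).
apply: (H_eigenvalue_odd_bipartite v0 unifE _ y0 yE EN).
by move: k_even; rewrite /= negbK.
Qed.
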